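(* Let $N$ be an oriented even-dimensional Riemannian manifold and let $\psi:M^{2m}\to\Sigma^+N$ be a $\mathcal{J}^1$-holomorphic map on a Hermitian manifold $M^{2m}$. Then the projected map $\varphi=\pi\circ\psi:M\to N$ is real isotropic.
   Context: A Hermitian manifold is an almost Hermitian manifold with integrable almost complex structure. A smooth map $\varphi:M\to N$ from a Hermitian manifold to a Riemannian manifold is real isotropic if $$\langle\nabla^{r-1}_{T^{10}M}\mathrm{d}\varphi(T^{10}M),\nabla^{s-1}_{T^{10}M}\mathrm{d}\varphi(T^{10}M)\rangle=0\quad\text{for all }r,s\geq1,$$ where $\langle\cdot,\cdot\rangle$ is the complex-bilinear extension of the metric of $N$ and $\nabla^{r}\mathrm{d}\varphi$ is the $r$-th covariant derivative of $\mathrm{d}\varphi$ (Levi-Civita connection of $M$ and pull-back connection on $\varphi^{-1}TN$) evaluated on $(1,0)$-vectors: $(\nabla^0\mathrm{d}\varphi)(X^{10})=\mathrm{d}\varphi(X^{10})$, $(\nabla^1_{Y^{10}}\mathrm{d}\varphi)(X^{10})=\nabla_{Y^{10}}(\mathrm{d}\varphi X^{10})-\mathrm{d}\varphi(\nabla_{Y^{10}}X^{10})$, and recursively $(\nabla^r\mathrm{d}\varphi)(Y_1,\dots,Y_r,X)=\nabla_{Y_1}\big(\nabla^{r-1}\mathrm{d}\varphi(Y_2,\dots,Y_r,X)\big)-\nabla^{r-1}\mathrm{d}\varphi(\nabla_{Y_1}Y_2,\dots,X)-\dots-\nabla^{r-1}\mathrm{d}\varphi(Y_2,\dots,\nabla_{Y_1}X)$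 for $(1,0)$-fields. Twistor space: $\pi:\Sigma^+N\to N$ is the bundle whose fibre at $x$ is the set of orthogonal $J:T_xN\to T_xN$ with $J^2=-\mathrm{Id}$ that are positive (bases $\{e_1,Je_1,\dots,e_n,Je_n\}$ are positively oriented). The Levi-Civita connection on $\mathrm{End}(TN)\supseteq\Sigma^+N$ gives $T\Sigma^+N=\mathcal{H}\oplus\mathcal{V}$ with $\mathcal{V}=\ker\mathrm{d}\pi$, $\mathcal{V}_{(x,J)}=\{\lambda\in\mathfrak{so}(T_xN):\lambda J=-J\lambda\}$. $\mathcal{J}^1$ is the almost complex structure equal to $(\mathrm{d}\pi|_{\mathcal{H}})^{-1}\circ J\circ\mathrm{d}\pi|_{\mathcal{H}}$ on $\mathcal{H}_{(x,J)}$ and to $\lambda\mapsto J\circ\lambda$ on $\mathcal{V}_{(x,J)}$. *)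

(* Defs.v *)
From mathcomp Require Import all_boot all_order all_algebra complex.
From mathcomp Require Import boolp classical_sets functions reals.
From mathcomp Require Import topology normedtype derive ring.

Set Implicit Arguments.
Unset Strict Implicit.
Unset Printing Implicit Defensive.

Import Order.TTheory GRing.Theory Num.Theory.
Import numFieldNormedType.Exports.

Local Open Scope classical_set_scope.
Local Open Scope complex_scope.
Local Open Scope ring_scope.

(* All geometric objects are described by their components in the charts of   *)
(* an atlas, together with the transformation laws under change of chart.     *)
(* Tangent vectors are column vectors, so that differentials and              *)
(* endomorphisms act by left multiplication.                                  *)

Section Calculus.
Context {R : realType}.

Definition partial n (f : 'cV[R]_n -> R) (i : 'I_n) (x : 'cV[R]_n) : R :=
  'D_(delta_mx i 0) f x.

(* Only meant for U open. *)
Fixpoint Ck_on n (k : nat) (U : set 'cV[R]_n) (f : 'cV[R]_n -> R) : Prop :=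
  match k with
  | 0 => forall x, U x -> {for x, continuous f}
  | k'.+1 => (forall x, U x -> differentiable f x) /\
             (forall i, Ck_on k' U (partial f i))
  end.

Definition smooth_on n (U : set 'cV[R]_n) p q (F : 'cV[R]_n -> 'M[R]_(p, q)) :=
  forall i j k, Ck_on k U (fun x => F x i j).

Definition jac n p (F : 'cV[R]_n -> 'cV[R]_p) (x : 'cV[R]_n) : 'M[R]_(p, n) :=
  \matrix_(k, i) partial (fun y => F y k 0) i x.

Definition bracket n (X Y : 'cV[R]_n -> 'cV[R]_n) (x : 'cV[R]_n) : 'cV[R]_n :=
  jac Y x *m X x - jac X x *m Y x.

(* The complexification of R^n is C^n with C = R[i]; functions with values in *)
(* it are differentiated through their real and imaginary parts.              *)

Definition csmooth_on n (U : set 'cV[R]_n) p (F : 'cV[R]_n -> 'cV[R[i]]_p) :=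
  smooth_on U (fun x => map_mx (@complex.Re R) (F x)) /\
  smooth_on U (fun x => map_mx (@complex.Im R) (F x)).

Definition cpartial n (f : 'cV[R]_n -> R[i]) (i : 'I_n) (x : 'cV[R]_n) : R[i] :=
  partial (fun y => complex.Re (f y)) i x +i*
  partial (fun y => complex.Im (f y)) i x.

(* Derivative of F at x in the complex direction v. *)
Definition cderive n p (F : 'cV[R]_n -> 'cV[R[i]]_p) (x : 'cV[R]_n)
    (v : 'cV[R[i]]_n) : 'cV[R[i]]_p :=
  \col_k \sum_(i < n) v i 0 * cpartial (fun y => F y k 0) i x.

Definition cmx p q (A : 'M[R]_(p, q)) : 'M[R[i]]_(p, q) :=
  map_mx (real_complex R) A.

(* Levi-Civita connection of the metric with components g, on an open subset  *)
(* of R^n:  Gamma^k_ij = 1/2 g^kl (d_i g_jl + d_j g_il - d_l g_ij).           *)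
Definition christoffel n (g : 'cV[R]_n -> 'M[R]_n) (x : 'cV[R]_n)
    (k i j : 'I_n) : R :=
  2^-1 * \sum_(l < n) invmx (g x) k l *
    (partial (fun y => g y j l) i x + partial (fun y => g y i l) j x
     - partial (fun y => g y i j) l x).

Definition conn_coef n (g : 'cV[R]_n -> 'M[R]_n) (x : 'cV[R]_n) (i : 'I_n)
    : 'M[R]_n := \matrix_(k, j) christoffel g x k i j.

(* Connection form, w |-> Gamma(v, w), for v real and for v complex. *)
Definition conn_form n (g : 'cV[R]_n -> 'M[R]_n) (x : 'cV[R]_n)
    (v : 'cV[R]_n) : 'M[R]_n :=
  \sum_(i < n) v i 0 *: conn_coef g x i.

Definition cconn_form n (g : 'cV[R]_n -> 'M[R]_n) (x : 'cV[R]_n)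
    (v : 'cV[R[i]]_n) : 'M[R[i]]_n :=
  \sum_(i < n) v i 0 *: cmx (conn_coef g x i).

(* Sanity check: at a point where g is symmetric and invertible, the symbols  *)
(* above are the only ones that are torsion free and compatible with g.       *)
Lemma levi_civita_characterization n (g : 'cV[R]_n -> 'M[R]_n)
    (x : 'cV[R]_n) (Gamma : 'I_n -> 'I_n -> 'I_n -> R) :
  (forall y, (g y)^T = g y) -> g x \in unitmx ->
  ((forall k i j, Gamma k i j = Gamma k j i) /\
   (forall i j k, partial (fun y => g y j k) i x =
      \sum_(l < n) (Gamma l i j * g x l k + Gamma l i k * g x j l)))
  <-> (forall k i j, Gamma k i j = christoffel g x k i j).
Proof.
move=> gsym gu.
have gs y i j : g y i j = g y j i by rewrite -[in LHS]gsym mxE.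
have n2 : (2 : R) != 0 by rewrite pnatr_eq0.
have dsym i j k : partial (fun y => g y j k) i x = partial (fun y => g y k j) i x.
  by congr partial; apply/funext => y; exact: gs.
pose K i j l := partial (fun y => g y j l) i x + partial (fun y => g y i l) j x
     - partial (fun y => g y i j) l x.
split.
- move=> [tf mc] k i j.
  have KE l : K i j l = 2 * \sum_(p < n) Gamma p i j * g x p l.
    rewrite /K !mc -big_split -sumrB mulr_sumr; apply: eq_bigr => p _ /=.
    rewrite (tf p j i) (tf p l i) (tf p l j) (gs x p j) (gs x p l).
    by ring.
  rewrite /christoffel.
  under eq_bigr => l _ do rewrite -/(K i j l) KE mulrCA.
  rewrite -mulr_sumr mulrA mulVf // mul1r.
  under eq_bigr => l _ do rewrite mulr_sumr.
  rewrite exchange_big /= (bigD1 k) //= [X in _ = _ + X]big1 ?addr0 => [|p pk].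
    under eq_bigr => l _ do rewrite mulrCA (gs x k l).
    rewrite -mulr_sumr.
    have := congr1 (fun A : 'M_n => A k k) (mulVmx gu).
    by rewrite !mxE eqxx => ->; rewrite mulr1.
  under eq_bigr => l _ do rewrite mulrCA (gs x p l).
  rewrite -mulr_sumr.
  have := congr1 (fun A : 'M_n => A k p) (mulVmx gu).
  by rewrite !mxE eq_sym (negbTE pk) => ->; rewrite mulr0.
- move=> GE; split.
    move=> k i j; rewrite !GE /christoffel; congr (_ * _); apply: eq_bigr => l _.
    by rewrite (dsym l i j) [in X in _ * (X - _)]addrC.
  have low i j k : \sum_(l < n) Gamma l i j * g x l k = 2^-1 * K i j k.
    under eq_bigr => l _ do
      rewrite GE /christoffel -mulrA mulr_suml.
    rewrite -mulr_sumr exchange_big /=; congr (_ * _).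
    rewrite (bigD1 k) //= [X in _ + X]big1 ?addr0 => [|q qk].
      rewrite (eq_bigr (fun l => K i j k * (g x k l * invmx (g x) l k))); last first.
        by move=> l _; rewrite -/(K i j k) (gs x l k); ring.
      rewrite -mulr_sumr.
      have := congr1 (fun A : 'M_n => A k k) (mulmxV gu).
      by rewrite !mxE eqxx => ->; rewrite mulr1.
    rewrite (eq_bigr (fun l => K i j q * (g x k l * invmx (g x) l q))); last first.
      by move=> l _; rewrite -/(K i j q) (gs x l k); ring.
    rewrite -mulr_sumr.
    have := congr1 (fun A : 'M_n => A k q) (mulmxV gu).
    by rewrite !mxE eq_sym (negbTE qk) => ->; rewrite mulr0.
  move=> i j k; rewrite big_split /= low.
  rewrite (eq_bigr (fun l => Gamma l i k * g x l j)); last by move=> l _; rewrite gs.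
  rewrite low /K (dsym i k j) (dsym k i j) (dsym j i k).
  by field.
Qed.

End Calculus.

Section Manifolds.
Context {R : realType}.

Record chart (T : topologicalType) (n : nat) := Chart {
  dom : set T;
  coord : T -> 'cV[R]_n;
  icoord : 'cV[R]_n -> T;
  dom_open : open dom;
  img_open : open (coord @` dom);
  coordK : forall p, dom p -> icoord (coord p) = p;
  coord_continuous : forall p, dom p -> {for p, continuous coord};
  icoord_continuous :
    forall x, (coord @` dom) x -> {for x, continuous icoord} }.

Record manifold (n : nat) := Manifold {
  space :> topologicalType;
  space_hausdorff : hausdorff_space space;
  space_second_countable : @second_countable space;
  chart_index : Type;
  atlas : chart_index -> chart space n;
  atlas_cover : forall p : space, exists a, dom (atlas a) p;
  atlas_smooth : forall a b,
    smooth_on (coord (atlas a) @` (dom (atlas a) `&` dom (atlas b)))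
      (coord (atlas b) \o icoord (atlas a)) }.

Section ManifoldNotions.
Variables (n : nat) (M : manifold n).

Definition mdom (a : chart_index M) : set M := dom (atlas a).
Definition mcoord (a : chart_index M) : M -> 'cV[R]_n := coord (atlas a).
Definition micoord (a : chart_index M) : 'cV[R]_n -> M := icoord (atlas a).
Definition mimg (a : chart_index M) : set 'cV[R]_n := mcoord a @` mdom a.

(* Differential of the change of coordinates from a to b. *)
Definition change (a b : chart_index M) (x : 'cV[R]_n) : 'M[R]_n :=
  jac (mcoord b \o micoord a) x.

End ManifoldNotions.

Section Maps.
Variables (m n : nat) (M : manifold m) (N : manifold n) (phi : M -> N).

Definition local_dom (a : chart_index M) (b : chart_index N) : set 'cV[R]_m :=
  mcoord a @` (mdom a `&` phi @^-1` mdom b).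

Definition local_rep (a : chart_index M) (b : chart_index N) : 'cV[R]_m -> 'cV[R]_n :=
  mcoord b \o phi \o micoord a.

Definition smooth_map : Prop :=
  continuous phi /\
  forall a b, smooth_on (local_dom a b) (local_rep a b).

End Maps.

Record riemannian_manifold (n : nat) := Riemannian {
  rmfd :> manifold n;
  metric : chart_index rmfd -> 'cV[R]_n -> 'M[R]_n;
  metric_smooth : forall a, smooth_on (mimg a) (metric a);
  metric_sym : forall a x, mimg a x -> (metric a x)^T = metric a x;
  metric_pos : forall a x (v : 'cV[R]_n), mimg a x -> v != 0 ->
    0 < (v^T *m metric a x *m v) 0 0;
  metric_change : forall a b p, mdom a p -> mdom b p ->
    let A := change a b (mcoord a p) in
    metric a (mcoord a p) = A^T *m metric b (mcoord b p) *m A }.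

(* The orientation is the one for which the coordinate bases of all charts of *)
(* the atlas are positive.                                                    *)
Record oriented_riemannian_manifold (n : nat) := OrientedRiemannian {
  ormfd :> riemannian_manifold n;
  atlas_oriented : forall (a b : chart_index ormfd) p, mdom a p -> mdom b p ->
    0 < \det (change a b (mcoord a p)) }.

Record almost_hermitian_manifold (n : nat) := AlmostHermitian {
  ahmfd :> riemannian_manifold n;
  acs : chart_index ahmfd -> 'cV[R]_n -> 'M[R]_n;
  acs_smooth : forall a, smooth_on (mimg a) (acs a);
  acs_square : forall a x, mimg a x -> acs a x *m acs a x = - 1%:M;
  acs_orthogonal : forall a x, mimg a x ->
    (acs a x)^T *m metric a x *m acs a x = metric a x;
  acs_change : forall a b p, mdom a p -> mdom b p ->
    let A := change a b (mcoord a p) in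
    A *m acs a (mcoord a p) = acs b (mcoord b p) *m A }.

Definition nijenhuis n (J : 'cV[R]_n -> 'M[R]_n) (X Y : 'cV[R]_n -> 'cV[R]_n)
    (x : 'cV[R]_n) : 'cV[R]_n :=
  let JX y := J y *m X y in let JY y := J y *m Y y in
  bracket JX JY x - J x *m bracket JX Y x - J x *m bracket X JY x
  - bracket X Y x.

(* Integrability is the vanishing of the Nijenhuis tensor (torsion) of J; a   *)
(* structure coming from holomorphic charts always satisfies it.              *)
Definition integrable_acs n (M : almost_hermitian_manifold n) : Prop :=
  forall (a : chart_index M) (V : set 'cV[R]_n) (X Y : 'cV[R]_n -> 'cV[R]_n),
    open V -> V `<=` mimg a -> smooth_on V X -> smooth_on V Y ->
    forall x, V x -> nijenhuis (acs a) X Y x = 0.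

Record hermitian_manifold (n : nat) := Hermitian {
  hmfd :> almost_hermitian_manifold n;
  acs_integrable : integrable_acs hmfd }.

End Manifolds.

Arguments manifold : clear implicits.
Arguments riemannian_manifold : clear implicits.
Arguments oriented_riemannian_manifold : clear implicits.
Arguments almost_hermitian_manifold : clear implicits.
Arguments hermitian_manifold : clear implicits.

Section RealIsotropic.
Context {R : realType}.
Variables (m n : nat) (M : hermitian_manifold R m) (N : riemannian_manifold R n) (phi : M -> N).

(* Covariant derivatives in the charts a of M and b of N: a vector field on M *)
(* is x |-> 'cV[R[i]]_m, a section of the complexified pull-back bundle       *)
(* phi^-1 TN is x |-> 'cV[R[i]]_n, x being the coordinate in a.               *)
Section InCharts.
Variables (a : chart_index M) (b : chart_index N).

Definition pushforward (Z : 'cV[R]_m -> 'cV[R[i]]_m) (x : 'cV[R]_m)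
    : 'cV[R[i]]_n :=
  cmx (jac (local_rep phi a b) x) *m Z x.

Definition nabla (Y Z : 'cV[R]_m -> 'cV[R[i]]_m) (x : 'cV[R]_m)
    : 'cV[R[i]]_m :=
  cderive Z x (Y x) + cconn_form (metric a) x (Y x) *m Z x.

Definition nabla_pullback (Y : 'cV[R]_m -> 'cV[R[i]]_m)
    (s : 'cV[R]_m -> 'cV[R[i]]_n) (x : 'cV[R]_m) : 'cV[R[i]]_n :=
  cderive s x (Y x) +
  cconn_form (metric b) (local_rep phi a b x) (pushforward Y x) *m s x.

(* nabla_d r Z = (nabla^r dphi)(Z_0, ..., Z_(r-1), Z_r), where Z_r is the     *)
(* argument of dphi and Z_0 is the outermost direction of differentiation.    *)
Fixpoint nabla_d (r : nat) :
    ('I_r.+1 -> 'cV[R]_m -> 'cV[R[i]]_m) -> 'cV[R]_m -> 'cV[R[i]]_n :=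
  match r with
  | 0 => fun Z => pushforward (Z ord0)
  | r'.+1 => fun Z x =>
      let Z' (k : 'I_r'.+1) := Z (lift ord0 k) in
      nabla_pullback (Z ord0) (nabla_d Z') x
      - \sum_(j < r'.+1)
          nabla_d (fun k => if k == j then nabla (Z ord0) (Z' k) else Z' k) x
  end.

End InCharts.

(* Smooth vector field of type (1,0) on V. *)
Definition field10 (a : chart_index M) (V : set 'cV[R]_m)
    (Z : 'cV[R]_m -> 'cV[R[i]]_m) : Prop :=
  csmooth_on V Z /\ forall x, V x -> cmx (acs a x) *m Z x = 'i%C *: Z x.

(* Complex-bilinear extension of the metric. *)
Definition cmetric (b : chart_index N) (y : 'cV[R]_n) (u v : 'cV[R[i]]_n) : R[i] :=
  (u^T *m cmx (metric b y) *m v) 0 0.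

Definition real_isotropic : Prop :=
  smooth_map phi /\
  forall (a : chart_index M) (b : chart_index N) (V : set 'cV[R]_m),
    open V -> V `<=` local_dom phi a b ->
    forall (r s : nat), (1 <= r)%N -> (1 <= s)%N ->
    forall (Z : 'I_r.-1.+1 -> 'cV[R]_m -> 'cV[R[i]]_m)
           (W : 'I_s.-1.+1 -> 'cV[R]_m -> 'cV[R[i]]_m),
      (forall k, field10 a V (Z k)) -> (forall k, field10 a V (W k)) ->
      forall x, V x ->
        cmetric b (local_rep phi a b x) (nabla_d a b Z x) (nabla_d a b W x) = 0.

End RealIsotropic.

Section Twistor.
Context {R : realType}.
Variables (n : nat) (N : oriented_riemannian_manifold R n.*2).

(* The odd-numbered columns of B being the J-images of their predecessors     *)
(* means that B is a family {e_1, J e_1, ..., e_n, J e_n}.                    *)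
Definition positive_endo (J : 'M[R]_n.*2) : Prop :=
  forall B : 'M[R]_n.*2,
    (forall k l : 'I_n.*2, ~~ odd k -> l = k.+1 :> nat ->
       col l B = J *m col k B) ->
    B \in unitmx -> 0 < \det B.

(* A point (x, J) of the twistor space Sigma^+ N. An endomorphism of T_x N is *)
(* the family of its matrices in the charts around x; the matrices attached   *)
(* to the other charts carry no information and are set to 0.                 *)
Record twistor := Twistor {
  twistor_proj : N;
  endo : chart_index N -> 'M[R]_n.*2;
  endo_change : forall a b, mdom a twistor_proj -> mdom b twistor_proj ->
    let A := change a b (mcoord a twistor_proj) in A *m endo a = endo b *m A;
  endo_outside : forall a, ~ mdom a twistor_proj -> endo a = 0;
  endo_orthogonal : forall a, mdom a twistor_proj ->
    (endo a)^T *m metric a (mcoord a twistor_proj) *m endo a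
    = metric a (mcoord a twistor_proj);
  endo_square : forall a, mdom a twistor_proj -> endo a *m endo a = - 1%:M;
  endo_positive : forall a, mdom a twistor_proj -> positive_endo (endo a) }.

(* A chart a of N induces the chart (x, J) |-> (coordinates of x, matrix of J)*)
(* of the total space of End(TN), which contains Sigma^+ N as a submanifold;  *)
(* tangent vectors of Sigma^+ N are represented by pairs (v, A) accordingly.  *)
(* The condition that lambda := vpart (v, A) be skew and anticommute with J   *)
(* is automatic for the differential of a map into Sigma^+ N, and is not      *)
(* needed to write down the formula for the almost complex structure J1.      *)
Section InChart.
Variables (a : chart_index N) (x : 'cV[R]_n.*2) (J : 'M[R]_n.*2).

(* Inverse of dpi on H: (v, A) is horizontal when A + [Gamma(v), J] = 0. *)
Definition hlift (v : 'cV[R]_n.*2) : 'cV[R]_n.*2 * 'M[R]_n.*2 :=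
  (v, J *m conn_form (metric a) x v - conn_form (metric a) x v *m J).

Definition vpart (w : 'cV[R]_n.*2 * 'M[R]_n.*2) : 'M[R]_n.*2 :=
  w.2 - (hlift w.1).2.

Definition J1 (w : 'cV[R]_n.*2 * 'M[R]_n.*2) : 'cV[R]_n.*2 * 'M[R]_n.*2 :=
  hlift (J *m w.1) + (0, J *m vpart w).

End InChart.

Section MapsToTwistor.
Variables (m : nat) (M : hermitian_manifold R m) (psi : M -> twistor).

Let phi : M -> N := twistor_proj \o psi.

Definition endo_rep (a : chart_index M) (b : chart_index N) (x : 'cV[R]_m) : 'M[R]_n.*2 :=
  endo (psi (micoord a x)) b.

Definition smooth_to_twistor : Prop :=
  smooth_map phi /\
  forall a b, smooth_on (local_dom phi a b) (endo_rep a b).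

Definition dpsi (a : chart_index M) (b : chart_index N) (x X : 'cV[R]_m)
    : 'cV[R]_n.*2 * 'M[R]_n.*2 :=
  (jac (local_rep phi a b) x *m X,
   \matrix_(k, l) \sum_(i < m)
      X i 0 * partial (fun y => endo_rep a b y k l) i x).

Definition J1_holomorphic : Prop :=
  smooth_to_twistor /\
  forall (a : chart_index M) (b : chart_index N) (x X : 'cV[R]_m), local_dom phi a b x ->
    dpsi a b x (acs a x *m X)
    = J1 b (local_rep phi a b x) (endo_rep a b x) (dpsi a b x X).

End MapsToTwistor.

End Twistor.

(* Main.v *)
Require Import Defs.
From mathcomp Require Import all_boot all_order all_algebra complex.
From mathcomp Require Import boolp classical_sets functions reals.
From mathcomp Require Import topology normedtype landau derive.
From mathcomp Require Import ring.

Set Implicit Arguments.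
Unset Strict Implicit.
Unset Printing Implicit Defensive.

Import Order.TTheory GRing.Theory Num.Theory.
Import numFieldNormedType.Exports.

Local Open Scope classical_set_scope.
Local Open Scope complex_scope.
Local Open Scope ring_scope.

(** Let E be the bundle of eigenvectors of eigenvalue i of J_psi in the
    complexified pull-back of TN by phi, where J_psi(p) is the complex structure
    of T_phi(p) N singled out by psi(p).  Since J_psi is orthogonal and the
    metric is extended bilinearly, E is isotropic: for u and w in E one has
    <u, w> = <J u, J w> = i^2 <u, w> ([eigenspace_isotropic]).  It is
    therefore enough to show that all (nabla^r dphi)(Z_0, ..., Z_r) on fields of
    type (1,0) are sections of E.  This goes by induction on r
    ([nabla_d10]), and rests on three facts.

    - The horizontal half of J1-holomorphy reads dphi J = J_psi dphi, so that
      dphi maps T^10 M into E ([pushforward10]).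

    - The vertical half reads nabla_(J X) J_psi = J_psi nabla_X J_psi.  For Y of
      type (1,0) this makes nabla_Y J_psi take its values in E ([nablaJ10]).
      Differentiating J_psi s = i s for a section s of E gives
      (nabla_Y J_psi) s = (i - J_psi) nabla_Y s.  The left side is in E and the
      right side in the other eigenbundle, so both vanish, and nabla_Y s is in E
      ([nabla_pullback10]).

    - On a Hermitian manifold nabla_Y Z is of type (1,0) when Y and Z are
      ([nabla10]).  For W of type (1,0), <nabla_Y Z, W> is symmetric in Y and Z,
      because integrability puts [Y, Z] in T^10 M ([bracket10]) and T^10 M is
      isotropic; it is skew in Z and W because <Z, W> vanishes identically.
      An expression symmetric in its first two arguments and skew in its last two
      is zero, and T^10 M is its own orthogonal ([eigenspace_orthogonal]).

    The remainder of the argument ensures that every field that gets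
    differentiated is smooth; this is obtained at once from the stability of the
    class of functions generated by smooth ones ([smooth_closure_step]). *)

(** * Partial derivatives *)

Lemma near_eq_differentiable {R : realType} (V W : normedModType R)
    (f g : V -> W) x :
  (\forall y \near x, f y = g y) -> differentiable f x -> differentiable g x.
Proof.
move=> fg df; have fgx : f x = g x by exact: nbhs_singleton fg.
have fgs : \forall h \near (0 : V), f (h + x) = g (h + x).
  by rewrite (near_shift x) /= sub0r; near do rewrite /= subrK.
have dg : g \o shift x = cst (g x) + 'd f x +o_ 0 id.
  move/diff_locally: (df) => /eqaddoE/eqaddoP H.
  apply/eqaddoP => e e0; near=> h.
  have fgh : f (h + x) = g (h + x) by near: h; exact: fgs.
  rewrite [X in `|X|](_ : _ = g (h + x) - (g x + 'd f x h)) //.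
  rewrite -fgh -fgx.
  by near: h; exact: H.
apply/diff_locallyP; rewrite (diff_unique (diff_continuous df) dg).
by split=> //; exact: diff_continuous df.
Unshelve. all: by end_near. Qed.

Section Locality.
Context {R : realType} {n : nat}.
Implicit Types (U : set 'cV[R]_n) (f g : 'cV[R]_n -> R) (x : 'cV[R]_n).

Lemma open_near U x (P : 'cV[R]_n -> Prop) :
  open U -> U x -> (forall y, U y -> P y) -> \forall y \near x, P y.
Proof.
by move=> Uo Ux UP; apply: filterS (open_nbhs_nbhs (conj Uo Ux)) => y /UP.
Qed.

Lemma partial_ext U f g i x : open U -> U x -> (forall y, U y -> f y = g y) ->
  partial f i x = partial g i x.
Proof.
by move=> Uo Ux fg; apply: near_eq_derive; apply: (open_near Uo Ux).
Qed.

Lemma differentiable_ext U f g x : open U -> U x ->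
  (forall y, U y -> f y = g y) -> differentiable f x -> differentiable g x.
Proof.
by move=> Uo Ux fg; apply: near_eq_differentiable; apply: (open_near Uo Ux).
Qed.

End Locality.

Section PartialRules.
Context {R : realType} {n : nat}.
Implicit Types (f g : 'cV[R]_n -> R) (x : 'cV[R]_n).

Lemma partial_cst (c : R) i x : partial (fun=> c) i x = 0.
Proof. exact: derive_cst. Qed.

Lemma partialD f g i x : differentiable f x -> differentiable g x ->
  partial (fun y => f y + g y) i x = partial f i x + partial g i x.
Proof. by move=> df dg; apply: deriveD; apply: diff_derivable. Qed.

Lemma partialN f i x : differentiable f x ->
  partial (fun y => - f y) i x = - partial f i x.
Proof. by move=> df; apply: deriveN; apply: diff_derivable. Qed.

Lemma partialM f g i x : differentiable f x -> differentiable g x ->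
  partial (fun y => f y * g y) i x = f x * partial g i x + g x * partial f i x.
Proof. by move=> df dg; apply: deriveM; apply: diff_derivable. Qed.

Lemma partialV f i x : differentiable f x -> f x != 0 ->
  partial (fun y => (f y)^-1) i x = - ((f x)^-1 * (f x)^-1 * partial f i x).
Proof.
move=> df fx; rewrite [LHS]deriveV //; last exact: diff_derivable.
by rewrite scaleNr expr2 invfM.
Qed.

Section Chain.
Variables (p : nat) (f : 'cV[R]_p -> R) (F : 'cV[R]_n -> 'cV[R]_p) (x : 'cV[R]_n).
Hypotheses (df : differentiable f (F x))
           (dF : forall k, differentiable (fun y => F y k 0) x).

Let F_sum : F = \sum_(k < p) (fun y => F y k 0 *: delta_mx k 0).
Proof.
apply/funext => y; rewrite fct_sumE; apply/colP => k.
rewrite summxE (bigD1 k) //= !mxE !eqxx mulr1 big1 ?addr0 // => l lk.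
by rewrite !mxE eq_sym (negbTE lk) mulr0.
Qed.

Let diffF : differentiable F x.
Proof.
by rewrite F_sum; apply: differentiable_sum => k; apply: differentiableZl.
Qed.

Lemma differentiable_chain : differentiable (fun y => f (F y)) x.
Proof. exact: (differentiable_comp diffF df). Qed.

Lemma partial_chain i :
  partial (fun y => f (F y)) i x =
  \sum_(k < p) partial f k (F x) * partial (fun y => F y k 0) i x.
Proof.
rewrite /partial -[LHS]/('D_(delta_mx i 0) (f \o F) x).
rewrite (deriveE _ differentiable_chain) (diff_comp diffF df) /=.
rewrite -(deriveE _ diffF) derive_mx; last exact: diff_derivable.
set w := \matrix_(_, _) _.
have -> : w = \sum_(k < p) w k 0 *: delta_mx k 0.
  apply/colP => k; rewrite summxE (bigD1 k) //= !mxE !eqxx mulr1.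
  by rewrite big1 ?addr0 // => l lk; rewrite !mxE eq_sym (negbTE lk) mulr0.
rewrite linear_sum; apply: eq_bigr => k _.
by rewrite linearZ /partial (deriveE _ df) mxE mulrC.
Qed.

End Chain.
End PartialRules.

(** * Smooth functions *)

Section SmoothFunctions.
Context {R : realType}.

Definition smooth_fun n (U : set 'cV[R]_n) (f : 'cV[R]_n -> R) : Prop :=
  forall k, Ck_on k U f.

(** All stability properties of smooth functions are proved together.  The
    functions below are differentiable and the class is stable under partial
    derivatives; this forces them to be smooth.  Treating sum, product and
    composition one by one would instead need a separate induction on the order
    of differentiability for each. *)
Inductive smooth_closure n (U : set 'cV[R]_n) : ('cV[R]_n -> R) -> Prop :=
| SmoothGen f : smooth_fun U f -> smooth_closure U f
| SmoothAdd f g : smooth_closure U f -> smooth_closure U g ->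
    smooth_closure U (fun x => f x + g x)
| SmoothMul f g : smooth_closure U f -> smooth_closure U g ->
    smooth_closure U (fun x => f x * g x)
| SmoothInv f : smooth_closure U f -> (forall x, U x -> f x != 0) ->
    smooth_closure U (fun x => (f x)^-1)
| SmoothComp p (W : set 'cV[R]_p) f (F : 'cV[R]_n -> 'cV[R]_p) :
    smooth_fun W f ->
    (forall k, smooth_closure U (fun x => F x k 0)) ->
    (forall x, U x -> W (F x)) -> smooth_closure U (fun x => f (F x))
| SmoothExt f g : (forall x, U x -> f x = g x) -> smooth_closure U f ->
    smooth_closure U g.

Lemma smooth_differentiable n (U : set 'cV[R]_n) f x :
  smooth_fun U f -> U x -> differentiable f x.
Proof. by move=> /(_ 1%N) [df _] /df. Qed.

Lemma smooth_partial n (U : set 'cV[R]_n) f i :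
  smooth_fun U f -> smooth_fun U (partial f i).
Proof. by move=> sf k; have [_] := sf k.+1; exact. Qed.

Section Basics.
Variables (n : nat) (U : set 'cV[R]_n).
Implicit Types f g : 'cV[R]_n -> R.

Lemma smooth_cst c : smooth_fun U (fun=> c).
Proof.
move=> k; elim: k c => [|k IHk] c /=; first by
  move=> x _; apply: differentiable_continuous; exact: differentiable_cst.
split=> [x _|i]; first exact: differentiable_cst.
rewrite (_ : partial _ i = fun=> 0); first exact: IHk.
by apply/funext => x; rewrite partial_cst.
Qed.

Lemma smooth_closure_sum p (F : 'I_p -> 'cV[R]_n -> R) :
  (forall k, smooth_closure U (F k)) ->
  smooth_closure U (fun x => \sum_(k < p) F k x).
Proof.
elim: p F => [|p IHp] F sF.
  rewrite (_ : (fun x => _) = fun=> 0); first exact: SmoothGen (smooth_cst _).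
  by apply/funext => x; rewrite big_ord0.
rewrite (_ : (fun x => _) =
  fun x => F ord0 x + \sum_(k < p) F (lift ord0 k) x); last first.
  by apply/funext => x; rewrite big_ord_recl.
by apply: SmoothAdd => //; apply: IHp.
Qed.

Lemma smooth_closure_opp f : smooth_closure U f ->
  smooth_closure U (fun x => - f x).
Proof.
move=> sf; apply: (@SmoothExt _ _ (fun x => -1 * f x)).
  by move=> x _; rewrite mulN1r.
by apply: SmoothMul => //; apply: SmoothGen; exact: smooth_cst.
Qed.

Hypothesis Uo : open U.

(** The rules of differential calculus express a partial derivative by means of
    the operations that generate the class. *)
Lemma smooth_closure_step f : smooth_closure U f ->
  (forall x, U x -> differentiable f x) /\
  (forall i, smooth_closure U (partial f i)).
Proof.
elim=> {f} [f sf|f g sf [df pf] sg [dg pg]|f g sf [df pf] sg [dg pg]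
           |f sf [df pf] f0|p W f F sf sF dF FW|f g fg sf [df pf]].
- split=> [x|i]; first exact: smooth_differentiable.
  by apply: SmoothGen; exact: smooth_partial.
- split=> [x Ux|i]; first by apply: differentiableD; [exact: df|exact: dg].
  apply: (@SmoothExt _ _ (fun x => partial f i x + partial g i x)).
    by move=> x Ux; rewrite partialD; [|exact: df|exact: dg].
  exact: SmoothAdd.
- split=> [x Ux|i]; first by apply: differentiableM; [exact: df|exact: dg].
  apply: (@SmoothExt _ _ (fun x => f x * partial g i x + g x * partial f i x)).
    by move=> x Ux; rewrite partialM; [|exact: df|exact: dg].
  by apply: SmoothAdd; exact: SmoothMul.
- split=> [x Ux|i]; first by apply: differentiableV; [exact: df|exact: f0].
  apply: (@SmoothExt _ _ (fun x => - ((f x)^-1 * (f x)^-1 * partial f i x))).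
    by move=> x Ux; rewrite partialV; [|exact: df|exact: f0].
  apply: smooth_closure_opp; apply: SmoothMul => //.
  by apply: SmoothMul; exact: SmoothInv.
- have df x : U x -> differentiable f (F x).
    by move=> Ux; exact: smooth_differentiable sf (FW x Ux).
  have dFx x k : U x -> differentiable (fun y => F y k 0) x.
    by move=> Ux; exact: (dF k).1.
  split=> [x Ux|i]; first by apply: differentiable_chain; auto.
  apply: (@SmoothExt _ _ (fun x => \sum_(k < p)
      partial f k (F x) * partial (fun y => F y k 0) i x)).
    by move=> x Ux; rewrite partial_chain //; auto.
  apply: smooth_closure_sum => k; apply: SmoothMul; last exact: (dF k).2.
  by apply: (SmoothComp _ _ FW) => //; exact: smooth_partial.
- split=> [x Ux|i]; first by apply: (differentiable_ext Uo Ux fg); exact: df.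
  apply: (@SmoothExt _ _ (partial f i)) => // x Ux; exact: (partial_ext _ Uo).
Qed.

Lemma smooth_closureE f : smooth_closure U f -> smooth_fun U f.
Proof.
move=> sf k; elim: k f sf => [|k IHk] f /smooth_closure_step[df pf] /=.
  by move=> x Ux; apply: differentiable_continuous; exact: df.
by split=> // i; exact: IHk.
Qed.

Lemma smoothD f g : smooth_fun U f -> smooth_fun U g ->
  smooth_fun U (fun x => f x + g x).
Proof.
by move=> sf sg; apply: smooth_closureE; apply: SmoothAdd; exact: SmoothGen.
Qed.

Lemma smoothM f g : smooth_fun U f -> smooth_fun U g ->
  smooth_fun U (fun x => f x * g x).
Proof.
by move=> sf sg; apply: smooth_closureE; apply: SmoothMul; exact: SmoothGen.
Qed.

Lemma smoothN f : smooth_fun U f -> smooth_fun U (fun x => - f x).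
Proof.
by move=> sf; apply: smooth_closureE; apply: smooth_closure_opp; exact: SmoothGen.
Qed.

Lemma smoothV f : smooth_fun U f -> (forall x, U x -> f x != 0) ->
  smooth_fun U (fun x => (f x)^-1).
Proof.
by move=> sf f0; apply: smooth_closureE; apply: SmoothInv => //; exact: SmoothGen.
Qed.

Lemma smooth_comp p (W : set 'cV[R]_p) (f : 'cV[R]_p -> R) F :
  smooth_fun W f -> smooth_on U F -> (forall x, U x -> W (F x)) ->
  smooth_fun U (fun x => f (F x)).
Proof.
move=> sf sF FW; apply: smooth_closureE; apply: (SmoothComp sf _ FW) => k.
by apply: SmoothGen; exact: sF.
Qed.

Lemma smooth_ext f g : (forall x, U x -> f x = g x) -> smooth_fun U f ->
  smooth_fun U g.
Proof.
move=> fg sf; apply: smooth_closureE; apply: (SmoothExt fg); exact: SmoothGen.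
Qed.

Lemma smooth_sum (I : Type) (r : seq I) (P : pred I) (F : I -> 'cV[R]_n -> R) :
  (forall k, smooth_fun U (F k)) ->
  smooth_fun U (fun x => \sum_(k <- r | P k) F k x).
Proof.
move=> sF; elim: r => [|k r IHr].
  by apply: (smooth_ext _ (smooth_cst 0)) => x _; rewrite big_nil.
case Pk : (P k).
  by apply: (smooth_ext _ (smoothD (sF k) IHr)) => x _; rewrite big_cons Pk.
by apply: (smooth_ext _ IHr) => x _; rewrite big_cons Pk.
Qed.

Lemma smooth_prod (I : Type) (r : seq I) (F : I -> 'cV[R]_n -> R) :
  (forall k, smooth_fun U (F k)) ->
  smooth_fun U (fun x => \prod_(k <- r) F k x).
Proof.
move=> sF; elim: r => [|k r IHr].
  by apply: (smooth_ext _ (smooth_cst 1)) => x _; rewrite big_nil.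
by apply: (smooth_ext _ (smoothM (sF k) IHr)) => x _; rewrite big_cons.
Qed.

End Basics.

Lemma smooth_subset n (U V : set 'cV[R]_n) f :
  V `<=` U -> smooth_fun U f -> smooth_fun V f.
Proof.
move=> VU sf k; elim: k f sf => [|k IHk] f sf /=.
  by move=> x /VU; exact: (sf 0).
split=> [x /VU|i]; first exact: smooth_differentiable.
by apply: IHk; exact: smooth_partial.
Qed.

Section Matrices.
Variables (n : nat) (U : set 'cV[R]_n).
Hypothesis Uo : open U.

Lemma smooth_det p (A : 'cV[R]_n -> 'M[R]_p) :
  smooth_on U A -> smooth_fun U (fun x => \det (A x)).
Proof.
move=> sA; apply: smooth_sum => // s; apply: smoothM => //.
  exact: smooth_cst.
by apply: smooth_prod => // i; exact: sA.
Qed.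

(** Cramer's formula. *)
Lemma smooth_invmx p (A : 'cV[R]_n -> 'M[R]_p) : smooth_on U A ->
  (forall x, U x -> A x \in unitmx) -> smooth_on U (fun x => invmx (A x)).
Proof.
move=> sA uA i j.
apply: (@smooth_ext _ _ Uo (fun x => (\det (A x))^-1 * cofactor (A x) j i)).
  by move=> x Ux; rewrite /invmx uA // !mxE.
apply: smoothM => //.
  apply: smoothV => //; first exact: smooth_det.
  by move=> x /uA; rewrite unitmxE unitfE.
apply: smoothM => //; first exact: smooth_cst.
apply: smooth_det => k l; apply: (smooth_ext Uo) (sA (lift j k) (lift i l)).
by move=> x _; rewrite !mxE.
Qed.

End Matrices.

End SmoothFunctions.

(** * Complex-valued functions and their derivatives *)

Section ComplexScalars.
Context {R : realType}.
Implicit Types z w : R[i].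

Lemma complexP z w : complex.Re z = complex.Re w ->
  complex.Im z = complex.Im w -> z = w.
Proof. by case: z => a b; case: w => c d /= -> ->. Qed.

Lemma complex_ReD z w : complex.Re (z + w) = complex.Re z + complex.Re w.
Proof. by case: z; case: w. Qed.

Lemma complex_ImD z w : complex.Im (z + w) = complex.Im z + complex.Im w.
Proof. by case: z; case: w. Qed.

Lemma complex_ReM z w : complex.Re (z * w) =
  complex.Re z * complex.Re w - complex.Im z * complex.Im w.
Proof. by case: z; case: w. Qed.

Lemma complex_ImM z w : complex.Im (z * w) =
  complex.Re z * complex.Im w + complex.Im z * complex.Re w.
Proof. by case: z; case: w. Qed.

Lemma imaginary_sq : 'i%C * 'i%C = -1 :> R[i].
Proof. by apply: complexP; rewrite ?complex_ReM ?complex_ImM /=; ring. Qed.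

Lemma eq_opp_0 (W : lmodType R[i]) (x : W) : x = - x -> x = 0.
Proof.
move=> xN; have : x *+ 2 = 0 by rewrite mulr2n {1}xN addNr.
by move/eqP; rewrite -scaler_nat scaler_eq0 pnatr_eq0 => /eqP.
Qed.

End ComplexScalars.

Section ComplexFunctions.
Context {R : realType}.
Variables (n : nat) (U : set 'cV[R]_n).
Implicit Types (f g : 'cV[R]_n -> R[i]) (x : 'cV[R]_n).

Definition csmooth_fun f : Prop :=
  smooth_fun U (fun x => complex.Re (f x)) /\
  smooth_fun U (fun x => complex.Im (f x)).

Lemma csmooth_real (f : 'cV[R]_n -> R) :
  smooth_fun U f -> csmooth_fun (fun x => (f x)%:C).
Proof. by move=> sf; split=> //; exact: smooth_cst. Qed.

Lemma csmooth_cst (c : R[i]) : csmooth_fun (fun=> c).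
Proof. by split; exact: smooth_cst. Qed.

Lemma csmooth_cpartial f i : csmooth_fun f -> csmooth_fun (cpartial f i).
Proof. by move=> [sR sI]; split; exact: smooth_partial. Qed.

Lemma cpartial_cst (c : R[i]) i x : cpartial (fun=> c) i x = 0.
Proof. by rewrite /cpartial !partial_cst. Qed.

Lemma cpartial_real (f : 'cV[R]_n -> R) i x :
  cpartial (fun y => (f y)%:C) i x = (partial f i x)%:C.
Proof. by rewrite /cpartial /= partial_cst. Qed.

Lemma cpartialD f g i x : csmooth_fun f -> csmooth_fun g -> U x ->
  cpartial (fun y => f y + g y) i x = cpartial f i x + cpartial g i x.
Proof.
move=> [fR fI] [gR gI] Ux; rewrite /cpartial.
under [in X in partial X]eq_fun do rewrite complex_ReD.
under [in X in _ +i* partial X _ _]eq_fun do rewrite complex_ImD.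
by rewrite !partialD //; apply: smooth_differentiable Ux.
Qed.

Lemma cpartialM f g i x : csmooth_fun f -> csmooth_fun g -> U x ->
  cpartial (fun y => f y * g y) i x = cpartial f i x * g x + f x * cpartial g i x.
Proof.
move=> [fR fI] [gR gI] Ux; rewrite /cpartial.
under [in X in partial X]eq_fun do rewrite complex_ReM.
under [in X in _ +i* partial X _ _]eq_fun do rewrite complex_ImM.
have dfR := smooth_differentiable fR Ux; have dfI := smooth_differentiable fI Ux.
have dgR := smooth_differentiable gR Ux; have dgI := smooth_differentiable gI Ux.
have dM := differentiableM.
rewrite partialD; [|exact: dM|exact/differentiableN/dM].
rewrite partialN; last exact: dM.
rewrite partialD; [|exact: dM|exact: dM].
rewrite !partialM //.
apply: complexP;
  by rewrite ?(complex_ReD, complex_ImD) ?(complex_ReM, complex_ImM) /=; ring.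
Qed.

Hypothesis Uo : open U.

Lemma cpartial_ext f g i x : U x -> (forall y, U y -> f y = g y) ->
  cpartial f i x = cpartial g i x.
Proof.
by move=> Ux fg; congr (_ +i* _); apply: (partial_ext _ Uo Ux) => y /fg ->.
Qed.

Lemma csmooth_ext f g : (forall x, U x -> f x = g x) -> csmooth_fun f ->
  csmooth_fun g.
Proof.
by move=> fg [sR sI]; split; [apply: smooth_ext sR|apply: smooth_ext sI];
  move=> // x /fg ->.
Qed.

Lemma csmoothD f g : csmooth_fun f -> csmooth_fun g ->
  csmooth_fun (fun x => f x + g x).
Proof.
move=> [fR fI] [gR gI]; split.
  by apply: (smooth_ext Uo _ (smoothD Uo fR gR)) => x _; rewrite complex_ReD.
by apply: (smooth_ext Uo _ (smoothD Uo fI gI)) => x _; rewrite complex_ImD.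
Qed.

Lemma csmoothM f g : csmooth_fun f -> csmooth_fun g ->
  csmooth_fun (fun x => f x * g x).
Proof.
move=> [fR fI] [gR gI]; split.
  apply: (smooth_ext Uo _ (smoothD Uo (smoothM Uo fR gR)
    (smoothN Uo (smoothM Uo fI gI)))) => x _; by rewrite complex_ReM.
by apply: (smooth_ext Uo _ (smoothD Uo (smoothM Uo fR gI) (smoothM Uo fI gR)))
  => x _; rewrite complex_ImM.
Qed.

Lemma csmooth_sum (I : Type) (r : seq I) (P : pred I) (F : I -> 'cV[R]_n -> R[i]) :
  (forall k, csmooth_fun (F k)) ->
  csmooth_fun (fun x => \sum_(k <- r | P k) F k x).
Proof.
move=> sF; elim: r => [|k r IHr].
  by apply: (csmooth_ext _ (csmooth_cst 0)) => x _; rewrite big_nil.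
case Pk : (P k).
  by apply: (csmooth_ext _ (csmoothD (sF k) IHr)) => x _; rewrite big_cons Pk.
by apply: (csmooth_ext _ IHr) => x _; rewrite big_cons Pk.
Qed.

Lemma cpartial_sum (I : Type) (r : seq I) (F : I -> 'cV[R]_n -> R[i]) i x :
  (forall k, csmooth_fun (F k)) -> U x ->
  cpartial (fun y => \sum_(k <- r) F k y) i x = \sum_(k <- r) cpartial (F k) i x.
Proof.
move=> sF Ux; elim: r => [|k r IHr].
  rewrite big_nil -[RHS](cpartial_cst 0 i x); congr cpartial.
  by apply/funext => y; rewrite big_nil.
rewrite big_cons -IHr -cpartialD //; last exact: csmooth_sum.
by congr cpartial; apply/funext => y; rewrite big_cons.
Qed.

End ComplexFunctions.

Section ComplexMatrices.
Context {R : realType}.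
Variables (n : nat) (U : set 'cV[R]_n).

Definition csmooth_mx p q (F : 'cV[R]_n -> 'M[R[i]]_(p, q)) : Prop :=
  forall i j, csmooth_fun U (fun x => F x i j).

Lemma csmooth_onP p (F : 'cV[R]_n -> 'cV[R[i]]_p) :
  csmooth_on U F <-> csmooth_mx F.
Proof.
have eR i j : (fun x => map_mx (@complex.Re R) (F x) i j) =
    (fun x => complex.Re (F x i j)) by apply/funext => x; rewrite mxE.
have eI i j : (fun x => map_mx (@complex.Im R) (F x) i j) =
    (fun x => complex.Im (F x i j)) by apply/funext => x; rewrite mxE.
split=> [[sR sI] i j|sF].
  by split; [have := sR i j; rewrite eR|have := sI i j; rewrite eI].
by split=> i j; rewrite ?eR ?eI; have [] := sF i j.
Qed.

(** Matrix-valued version of [cderive], for which the Leibniz rule can be stated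
    for matrix products of any shape. *)
Definition mderive p q (F : 'cV[R]_n -> 'M[R[i]]_(p, q)) (x : 'cV[R]_n)
    (v : 'cV[R[i]]_n) : 'M[R[i]]_(p, q) :=
  \sum_(i < n) v i 0 *: \matrix_(k, l) cpartial (fun y => F y k l) i x.

Lemma mderiveE p q (F : 'cV[R]_n -> 'M[R[i]]_(p, q)) x v k l :
  mderive F x v k l = \sum_(i < n) v i 0 * cpartial (fun y => F y k l) i x.
Proof. by rewrite summxE; apply: eq_bigr => i _; rewrite !mxE. Qed.

Lemma cderiveE p (F : 'cV[R]_n -> 'cV[R[i]]_p) x v :
  cderive F x v = mderive F x v.
Proof. by apply/colP => k; rewrite mderiveE mxE. Qed.

Lemma mderive_lin p q (F : 'cV[R]_n -> 'M[R[i]]_(p, q)) x a u v :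
  mderive F x (a *: u + v) = a *: mderive F x u + mderive F x v.
Proof.
rewrite scaler_sumr -big_split /=; apply: eq_bigr => i _.
by rewrite !mxE scalerDl scalerA.
Qed.

Lemma mderive_trmx p q (F : 'cV[R]_n -> 'M[R[i]]_(p, q)) x v :
  mderive (fun y => (F y)^T) x v = (mderive F x v)^T.
Proof.
apply/matrixP => k l; rewrite [RHS]mxE !mderiveE; apply: eq_bigr => i _.
rewrite (_ : (fun y => _) = (fun y => F y l k)) //.
by apply/funext => y; rewrite mxE.
Qed.

Lemma mderive_cst p q (A : 'M[R[i]]_(p, q)) x v : mderive (fun=> A) x v = 0.
Proof.
apply/matrixP => k l; rewrite mderiveE mxE big1 // => i _.
by rewrite cpartial_cst mulr0.
Qed.

Lemma csmooth_cmx p q (A : 'cV[R]_n -> 'M[R]_(p, q)) :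
  smooth_on U A -> csmooth_mx (fun x => cmx (A x)).
Proof.
move=> sA i j; rewrite (_ : (fun x => _) = fun x => (A x i j)%:C).
  exact/csmooth_real/sA.
by apply/funext => x; rewrite mxE.
Qed.

Lemma csmooth_mx_cst p q (A : 'M[R[i]]_(p, q)) : csmooth_mx (fun=> A).
Proof. by move=> i j; exact: csmooth_cst. Qed.

Hypothesis Uo : open U.

Lemma mderive_ext p q (F G : 'cV[R]_n -> 'M[R[i]]_(p, q)) x v :
  U x -> (forall y, U y -> F y = G y) -> mderive F x v = mderive G x v.
Proof.
move=> Ux FG; apply/matrixP => k l; rewrite !mderiveE; apply: eq_bigr => i _.
by congr (_ * _); apply: (@cpartial_ext _ _ U) => // y /FG ->.
Qed.

Lemma mderiveM p q r (F : 'cV[R]_n -> 'M[R[i]]_(p, q))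
    (G : 'cV[R]_n -> 'M[R[i]]_(q, r)) x v :
  csmooth_mx F -> csmooth_mx G -> U x ->
  mderive (fun y => F y *m G y) x v =
  mderive F x v *m G x + F x *m mderive G x v.
Proof.
move=> sF sG Ux; apply/matrixP => k l; rewrite mderiveE !mxE -big_split /=.
under [RHS]eq_bigr => j _.
  rewrite !mderiveE mulr_suml mulr_sumr -big_split /=.
  over.
rewrite exchange_big /=; apply: eq_bigr => i _.
rewrite (_ : (fun y => _) = (fun y => \sum_j F y k j * G y j l)); last first.
  by apply/funext => y; rewrite mxE.
rewrite (cpartial_sum Uo) //; last by move=> j; exact: csmoothM.
rewrite mulr_sumr; apply: eq_bigr => j _.
by rewrite (cpartialM _ (sF k j) (sG j l) Ux); ring.
Qed.

Lemma csmooth_mxM p q r (F : 'cV[R]_n -> 'M[R[i]]_(p, q))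
    (G : 'cV[R]_n -> 'M[R[i]]_(q, r)) :
  csmooth_mx F -> csmooth_mx G -> csmooth_mx (fun x => F x *m G x).
Proof.
move=> sF sG i j; apply: (@csmooth_ext _ _ _ Uo
    (fun x => \sum_k F x i k * G x k j)).
  by move=> x _; rewrite mxE.
by apply: csmooth_sum => // k; exact: csmoothM.
Qed.

Lemma csmooth_mxD p q (F G : 'cV[R]_n -> 'M[R[i]]_(p, q)) :
  csmooth_mx F -> csmooth_mx G -> csmooth_mx (fun x => F x + G x).
Proof.
move=> sF sG i j.
apply: (csmooth_ext Uo) (csmoothD Uo (sF i j) (sG i j)) => x _.
by rewrite mxE.
Qed.

Lemma csmooth_mxZ p q (f : 'cV[R]_n -> R[i]) (F : 'cV[R]_n -> 'M[R[i]]_(p, q)) :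
  csmooth_fun U f -> csmooth_mx F -> csmooth_mx (fun x => f x *: F x).
Proof.
move=> sf sF i j.
apply: (csmooth_ext Uo) (csmoothM Uo sf (sF i j)) => x _.
by rewrite mxE.
Qed.

Lemma csmooth_mx_sum p q (I : Type) (r : seq I)
    (F : I -> 'cV[R]_n -> 'M[R[i]]_(p, q)) :
  (forall k, csmooth_mx (F k)) -> csmooth_mx (fun x => \sum_(k <- r) F k x).
Proof.
move=> sF i j.
apply: (csmooth_ext Uo) (csmooth_sum Uo r xpredT (fun k => sF k i j)) => x _.
by rewrite summxE.
Qed.

Lemma csmooth_mderive p q (F : 'cV[R]_n -> 'M[R[i]]_(p, q)) v :
  csmooth_mx F -> csmooth_mx v -> csmooth_mx (fun x => mderive F x (v x)).
Proof.
move=> sF sv; apply: csmooth_mx_sum => i; apply: csmooth_mxZ; first exact: sv.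
move=> k l; apply: (csmooth_ext Uo) (csmooth_cpartial i (sF k l)) => x _.
by rewrite mxE.
Qed.

End ComplexMatrices.

(** * The Levi-Civita connection in a chart *)

Section LeviCivita.
Context {R : realType}.
Variables (n : nat) (g : 'cV[R]_n -> 'M[R]_n) (U : set 'cV[R]_n).
Hypotheses (Uo : open U) (gsmooth : smooth_on U g)
  (gsym : forall x, U x -> (g x)^T = g x)
  (gunit : forall x, U x -> g x \in unitmx).

(** [levi_civita_characterization] asks for a metric that is symmetric
    everywhere.  It is applied to the symmetrization of g, which agrees with g on
    the open set U and so has the same symbols there. *)
Lemma levi_civita_on x : U x ->
  (forall k i j, christoffel g x k i j = christoffel g x k j i) /\
  (forall i j k, partial (fun y => g y j k) i x =
     \sum_(l < n) (christoffel g x l i j * g x l k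
                   + christoffel g x l i k * g x j l)).
Proof.
move=> Ux.
pose h y := 2^-1 *: (g y + (g y)^T).
have hg y : U y -> h y = g y.
  move=> Uy; rewrite /h gsym // -mulr2n -[g y *+ 2]scaler_nat scalerA.
  by rewrite mulVf ?scale1r ?pnatr_eq0.
have hsym y : (h y)^T = h y by rewrite /h linearZ linearD /= trmxK addrC.
have ph i j k : partial (fun y => h y j k) i x = partial (fun y => g y j k) i x.
  by apply: (partial_ext _ Uo Ux) => y /hg ->.
have ch k i j : christoffel h x k i j = christoffel g x k i j.
  rewrite /christoffel hg //; congr (_ * _); apply: eq_bigr => l _.
  by rewrite !ph.
have hu : h x \in unitmx by rewrite hg // gunit.
have [_ /(_ (fun k i j => erefl))[sy co]] :=
  levi_civita_characterization (christoffel h x) hsym hu.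
split=> [k i j|i j k]; first by rewrite -!ch.
by rewrite -ph co; apply: eq_bigr => l _; rewrite !ch hg.
Qed.

Lemma cconn_form_lin x a u v :
  cconn_form g x (a *: u + v) = a *: cconn_form g x u + cconn_form g x v.
Proof.
rewrite scaler_sumr -big_split /=; apply: eq_bigr => i _.
by rewrite !mxE scalerDl scalerA.
Qed.

(** Absence of torsion. *)
Lemma cconn_form_sym x u v : U x ->
  cconn_form g x u *m v = cconn_form g x v *m u.
Proof.
move=> /levi_civita_on[sy _]; apply/colP => k; rewrite !mxE.
under eq_bigr => j _ do rewrite summxE mulr_suml.
under [RHS]eq_bigr => j _ do rewrite summxE mulr_suml.
rewrite exchange_big /=; apply: eq_bigr => i _; apply: eq_bigr => j _.
by rewrite !mxE sy; ring.
Qed.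

(** Compatibility with the metric. *)
Lemma mderive_metric x v : U x ->
  mderive (fun y => cmx (g y)) x v =
  (cconn_form g x v)^T *m cmx (g x) + cmx (g x) *m cconn_form g x v.
Proof.
move=> /levi_civita_on[_ co].
rewrite linear_sum mulmx_suml mulmx_sumr -big_split /=; apply: eq_bigr => i _.
rewrite linearZ /= -scalemxAl -scalemxAr -scalerDr; congr (_ *: _).
apply/matrixP => j k; rewrite mxE.
rewrite (_ : (fun y => _) = (fun y => (g y j k)%:C)); last first.
  by apply/funext => y; rewrite mxE.
rewrite cpartial_real co !mxE -big_split /= rmorph_sum; apply: eq_bigr => l _.
by rewrite !mxE rmorphD !rmorphM /=; ring.
Qed.

Lemma smooth_conn_coef i : smooth_on U (fun x => conn_coef g x i).
Proof.
move=> k j; apply: (@smooth_ext _ _ _ Uo (fun x => christoffel g x k i j)).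
  by move=> x _; rewrite mxE.
apply: smoothM => //; first exact: smooth_cst.
apply: smooth_sum => // l; apply: smoothM => //; first exact: smooth_invmx.
apply: smoothD => //; last by apply: smoothN => //; exact: smooth_partial.
by apply: smoothD => //; exact: smooth_partial.
Qed.

End LeviCivita.

Lemma metric_unitmx (R : realType) n (N : riemannian_manifold R n)
    (b : chart_index N) x : mimg b x -> metric b x \in unitmx.
Proof.
move=> bx; rewrite -row_free_unit -kermx_eq0.
apply/negPn/negP => /rowV0Pn[v /sub_kermxP vA v0].
have := @metric_pos _ _ _ b x v^T bx.
by rewrite trmx_eq0 trmxK vA mul0mx mxE ltxx => /(_ v0).
Qed.

(** * Eigenspaces of an orthogonal complex structure *)

Section Isotropy.
Context {R : realType}.

Lemma cmxM p q r (A : 'M[R]_(p, q)) (B : 'M[R]_(q, r)) :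
  cmx (A *m B) = cmx A *m cmx B.
Proof. exact: map_mxM. Qed.

Lemma cmx_trmx p q (A : 'M[R]_(p, q)) : cmx A^T = (cmx A)^T.
Proof. by apply/matrixP => i j; rewrite !mxE. Qed.

Lemma cmxN p q (A : 'M[R]_(p, q)) : cmx (- A) = - cmx A.
Proof. exact: map_mxN. Qed.

Variables (n : nat) (g J : 'M[R]_n).
Hypothesis orthJ : J^T *m g *m J = g.

(** <u, w> = <J u, J w> = i^2 <u, w>. *)
Lemma eigenspace_isotropic (u w : 'cV[R[i]]_n) :
  cmx J *m u = 'i%C *: u -> cmx J *m w = 'i%C *: w ->
  u^T *m cmx g *m w = 0.
Proof.
move=> Ju Jw; set q := _ *m w.
apply: eq_opp_0.
rewrite {1}/q -orthJ !cmxM cmx_trmx.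
rewrite !mulmxA -trmx_mul Ju -(mulmxA _ (cmx J)) Jw.
by rewrite -scalemxAr (linearZ _ u) -!scalemxAl scalerA imaginary_sq scaleN1r.
Qed.

Hypotheses (squareJ : J *m J = - 1%:M) (gunit : g \in unitmx).

Lemma eigenspace_projection (u : 'cV[R[i]]_n) :
  let w := u - 'i%C *: (cmx J *m u) in cmx J *m w = 'i%C *: w.
Proof.
rewrite /= mulmxBr -scalemxAr mulmxA -cmxM squareJ cmxN /cmx map_mx1.
rewrite mulNmx mul1mx scalerN opprK scalerBr scalerA imaginary_sq scaleN1r opprK.
by rewrite addrC.
Qed.

(** The eigenspace contains all (1 - i J) u.  As J is skew, orthogonality of v
    to these vectors says that v + i J v is orthogonal to every u. *)
Lemma eigenspace_orthogonal (v : 'cV[R[i]]_n) :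
  (forall w : 'cV[R[i]]_n, cmx J *m w = 'i%C *: w -> v^T *m cmx g *m w = 0) ->
  cmx J *m v = 'i%C *: v.
Proof.
move=> vperp.
have skewJ : g *m J = - (J^T *m g).
  have := congr1 (mulmx^~ J) orthJ.
  by rewrite -(mulmxA _ J) squareJ mulmxN mulmx1 => <-.
have E : v^T *m cmx g *m (1%:M - 'i%C *: cmx J) = 0.
  apply/row_matrixP => i0; apply/rowP => k; rewrite row0 ord1.
  have := vperp _ (eigenspace_projection (delta_mx k 0)).
  have Eu (u : 'cV[R[i]]_n) :
      u - 'i%C *: (cmx J *m u) = (1%:M - 'i%C *: cmx J) *m u.
    by rewrite mulmxBl mul1mx scalemxAl.
  rewrite Eu.
  by rewrite mulmxA -colE => /(congr1 (fun A : 'M_(_, _) => A 0 0)); rewrite !mxE.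
have {}E : (v + 'i%C *: (cmx J *m v))^T *m cmx g = 0.
  rewrite -[RHS]E mulmxBr mulmx1 -scalemxAr -mulmxA -cmxM skewJ.
  rewrite cmxN cmxM cmx_trmx mulmxN mulmxA -trmx_mul.
  by rewrite scalerN opprK linearD mulmxDl linearZ /= scalemxAl.
have gC : cmx g \in unitmx by rewrite map_unitmx.
have {}E : v + 'i%C *: (cmx J *m v) = 0.
  by apply: trmx_inj; rewrite -(mulmxK gC (_ ^T)) E mul0mx linear0.
move/eqP: E; rewrite addr_eq0 => /eqP vE; rewrite [in RHS]vE.
by rewrite scalerN scalerA imaginary_sq scaleN1r opprK.
Qed.

End Isotropy.

(** * Real and imaginary parts of vector fields *)

Section RealAndImaginaryParts.
Context {R : realType}.

Definition Remx p q (A : 'M[R[i]]_(p, q)) : 'M[R]_(p, q) :=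
  map_mx (@complex.Re R) A.
Definition Immx p q (A : 'M[R[i]]_(p, q)) : 'M[R]_(p, q) :=
  map_mx (@complex.Im R) A.

Lemma cmatrixP p q (A B : 'M[R[i]]_(p, q)) :
  Remx A = Remx B -> Immx A = Immx B -> A = B.
Proof.
move=> eR eI; apply/matrixP => k l; apply: complexP.
  by have := congr1 (fun C : 'M_(_, _) => C k l) eR; rewrite !mxE.
by have := congr1 (fun C : 'M_(_, _) => C k l) eI; rewrite !mxE.
Qed.

Lemma cmatrix_split p q (A : 'M[R[i]]_(p, q)) :
  A = 'i%C *: cmx (Immx A) + cmx (Remx A).
Proof.
apply/matrixP => k l; rewrite !mxE.
apply: complexP;
  by rewrite ?(complex_ReD, complex_ImD) ?(complex_ReM, complex_ImM) /=; ring.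
Qed.

Lemma complex_Re_sum (I : Type) (r : seq I) (F : I -> R[i]) :
  complex.Re (\sum_(k <- r) F k) = \sum_(k <- r) complex.Re (F k).
Proof. exact: (big_morph _ (@complex_ReD R)). Qed.

Lemma complex_Im_sum (I : Type) (r : seq I) (F : I -> R[i]) :
  complex.Im (\sum_(k <- r) F k) = \sum_(k <- r) complex.Im (F k).
Proof. exact: (big_morph _ (@complex_ImD R)). Qed.

Lemma Remx_cmxM p q r (A : 'M[R]_(p, q)) (B : 'M[R[i]]_(q, r)) :
  Remx (cmx A *m B) = A *m Remx B.
Proof.
apply/matrixP => k l; rewrite !mxE complex_Re_sum; apply: eq_bigr => j _.
by rewrite [complex.Re _]complex_ReM !mxE /=; ring.
Qed.

Lemma Immx_cmxM p q r (A : 'M[R]_(p, q)) (B : 'M[R[i]]_(q, r)) :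
  Immx (cmx A *m B) = A *m Immx B.
Proof.
apply/matrixP => k l; rewrite !mxE complex_Im_sum; apply: eq_bigr => j _.
by rewrite [complex.Im _]complex_ImM !mxE /=; ring.
Qed.

Lemma RemxB p q (A B : 'M[R[i]]_(p, q)) : Remx (A - B) = Remx A - Remx B.
Proof. by apply/matrixP => k l; rewrite !mxE complex_ReD; case: (B k l). Qed.

Lemma ImmxB p q (A B : 'M[R[i]]_(p, q)) : Immx (A - B) = Immx A - Immx B.
Proof. by apply/matrixP => k l; rewrite !mxE complex_ImD; case: (B k l). Qed.

Lemma Remx_i p q (A : 'M[R[i]]_(p, q)) : Remx ('i%C *: A) = - Immx A.
Proof. by apply/matrixP => k l; rewrite !mxE complex_ReM /=; ring. Qed.

Lemma Immx_i p q (A : 'M[R[i]]_(p, q)) : Immx ('i%C *: A) = Remx A.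
Proof. by apply/matrixP => k l; rewrite !mxE complex_ImM /=; ring. Qed.

Lemma Remx_cderive n p (F : 'cV[R]_n -> 'cV[R[i]]_p) x v :
  Remx (cderive F x v) =
  jac (Remx (q:=1) \o F) x *m Remx v - jac (Immx (q:=1) \o F) x *m Immx v.
Proof.
apply/colP => k; rewrite !mxE complex_Re_sum -sumrB; apply: eq_bigr => i _.
rewrite [complex.Re _]complex_ReM !mxE /=.
have -> : (fun y => Remx (F y) k 0) = (fun y => complex.Re (F y k 0)).
  by apply/funext => y; rewrite mxE.
have -> : (fun y => Immx (F y) k 0) = (fun y => complex.Im (F y k 0)).
  by apply/funext => y; rewrite mxE.
by ring.
Qed.

Lemma Immx_cderive n p (F : 'cV[R]_n -> 'cV[R[i]]_p) x v :
  Immx (cderive F x v) =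
  jac (Remx (q:=1) \o F) x *m Immx v + jac (Immx (q:=1) \o F) x *m Remx v.
Proof.
apply/colP => k; rewrite !mxE complex_Im_sum -big_split /=; apply: eq_bigr => i _.
rewrite [complex.Im _]complex_ImM !mxE /=.
have -> : (fun y => Remx (F y) k 0) = (fun y => complex.Re (F y k 0)).
  by apply/funext => y; rewrite mxE.
have -> : (fun y => Immx (F y) k 0) = (fun y => complex.Im (F y k 0)).
  by apply/funext => y; rewrite mxE.
by ring.
Qed.

End RealAndImaginaryParts.

(** * Fields of type (1,0) on a Hermitian manifold *)

Section HolomorphicTangentBundle.
Context {R : realType}.
Variables (m : nat) (M : hermitian_manifold R m) (a : chart_index M).
Variable V : set 'cV[R]_m.
Hypotheses (Vo : open V) (Va : V `<=` mimg a).
Implicit Types Y Z W : 'cV[R]_m -> 'cV[R[i]]_m.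

Let J := acs a.
Let g := metric a.

Let gsmooth : smooth_on V g.
Proof. by move=> i j; apply: (smooth_subset Va) => k; exact: metric_smooth. Qed.

Let gsym x : V x -> (g x)^T = g x.
Proof. by rewrite /g => /Va; exact: Defs.metric_sym. Qed.

Let gunit x : V x -> g x \in unitmx.
Proof. by rewrite /g => /Va; exact: metric_unitmx. Qed.

Let Jsmooth : smooth_on V J.
Proof. by move=> i j; apply: (smooth_subset Va) => k; exact: acs_smooth. Qed.

Let Jsq x : V x -> J x *m J x = - 1%:M.
Proof. by rewrite /J => /Va; exact: acs_square. Qed.

Let Jorth x : V x -> (J x)^T *m g x *m J x = g x.
Proof. by rewrite /J /g => /Va; exact: acs_orthogonal. Qed.

Lemma field10_smooth Z : field10 a V Z -> csmooth_mx V Z.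
Proof. by move=> [/csmooth_onP]. Qed.

Lemma jac_JRe Z x : field10 a V Z -> V x ->
  jac (fun y => J y *m Remx (Z y)) x = - jac (Immx (q:=1) \o Z) x.
Proof.
move=> fZ Vx; apply/matrixP => k i; rewrite !mxE.
rewrite (partial_ext (U := V) (g := fun y => - Immx (Z y) k 0)) //.
  rewrite partialN //; apply: smooth_differentiable Vx.
  by case: fZ => -[_ sI] _; exact: sI.
move=> y Vy; case: fZ => _ /(_ y Vy) /(congr1 (@Remx _ _ _)).
by rewrite Remx_cmxM Remx_i => ->; rewrite mxE.
Qed.

(** A field of type (1,0) is A - i J A with A its real part.  For two such fields
    the Nijenhuis tensor of the real parts is - Re B + J Im B, where B is their
    complex bracket; its vanishing means that B is of type (1,0). *)
Lemma bracket10 Y Z x : field10 a V Y -> field10 a V Z -> V x ->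
  let B := cderive Z x (Y x) - cderive Y x (Z x) in
  cmx (J x) *m B = 'i%C *: B.
Proof.
move=> fY fZ Vx B.
have JRe W : field10 a V W -> J x *m Remx (W x) = - Immx (W x).
  by case=> _ /(_ x Vx) /(congr1 (@Remx _ _ _)); rewrite Remx_cmxM Remx_i.
have RB : Remx B = J x *m Immx B.
  have := @acs_integrable _ _ M a V _ _ Vo Va fY.1.1 fZ.1.1 x Vx.
  rewrite /nijenhuis /bracket -/J !jac_JRe // !JRe //.
  rewrite RemxB ImmxB !Remx_cderive !Immx_cderive.
  rewrite !(mulmxN, mulNmx, mulmxDr, mulmxBr, opprK, opprD).
  rewrite -/(Remx (Y x)) -/(Remx (Z x)).
  set y1 := Remx (Y x); set y2 := Immx (Y x).
  set z1 := Remx (Z x); set z2 := Immx (Z x).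
  rewrite -![jac (fun y => map_mx _ (_ y)) x]/(jac (Remx (q:=1) \o _) x).
  move=> N0; apply/subr0_eq; rewrite -[RHS]oppr0 -N0.
  by apply/matrixP => k l; rewrite !mxE; ring.
apply: cmatrixP; rewrite ?Remx_cmxM ?Immx_cmxM ?Remx_i ?Immx_i.
  by rewrite RB mulmxA Jsq // mulNmx mul1mx.
by rewrite -RB.
Qed.

Lemma nablaE Y Z x :
  nabla a Y Z x = mderive Z x (Y x) + cconn_form g x (Y x) *m Z x.
Proof. by rewrite /nabla cderiveE. Qed.

Lemma csmooth_nabla Y Z : csmooth_mx V Y -> csmooth_mx V Z ->
  csmooth_mx V (nabla a Y Z).
Proof.
move=> sY sZ.
rewrite (_ : nabla a Y Z = fun x => mderive Z x (Y x) + cconn_form g x (Y x) *m Z x).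
  apply: csmooth_mxD => //; first exact: csmooth_mderive.
  apply: csmooth_mxM => //; apply: csmooth_mx_sum => // i.
  apply: csmooth_mxZ => //.
  by apply: csmooth_cmx; exact: smooth_conn_coef.
by apply/funext => x; exact: nablaE.
Qed.

Let tau Y Z W x : R[i] := ((nabla a Y Z x)^T *m cmx (g x) *m W x) 0 0.

(** Derivative of <Z, W> = 0 along Y. *)
Let tau_antisym Y Z W x : field10 a V Z -> field10 a V W -> V x ->
  tau Y Z W x = - tau Y W Z x.
Proof.
move=> fZ fW Vx; have sZ := field10_smooth fZ; have sW := field10_smooth fW.
have sg : csmooth_mx V (fun y => cmx (g y)) by exact: csmooth_cmx.
have sZt : csmooth_mx V (fun y => (Z y)^T).
  move=> i j; apply: (csmooth_ext Vo) (sZ j i) => y _; by rewrite mxE.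
have : mderive (fun y => (Z y)^T *m cmx (g y) *m W y) x (Y x) = 0.
  rewrite (@mderive_ext _ _ V Vo _ _ _ (fun=> 0)) //; first exact: mderive_cst.
  by move=> y Vy; apply: (eigenspace_isotropic (Jorth Vy)); [exact: fZ.2|exact: fW.2].
rewrite (mderiveM Vo) // ?(mderiveM Vo) //; last exact: csmooth_mxM.
rewrite mderive_trmx (mderive_metric Vo gsym gunit) // => E0.
have : (nabla a Y Z x)^T *m cmx (g x) *m W x +
       ((nabla a Y W x)^T *m cmx (g x) *m Z x)^T = 0.
  rewrite -E0 !nablaE !trmx_mul trmxK -cmx_trmx gsym //.
  rewrite linearD /= trmx_mul !(mulmxDl, mulmxDr) !mulmxA !addrA.
  exact: addrAC.
move=> /(congr1 (fun A : 'M_(_, _) => A 0 0)) /eqP.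
by rewrite mxE [X in _ + X]mxE [X in _ == X]mxE addr_eq0 => /eqP.
Qed.

(** The difference of the two sides is <[Y, Z], W>. *)
Let tau_sym Y Z W x : field10 a V Y -> field10 a V Z -> field10 a V W -> V x ->
  tau Y Z W x = tau Z Y W x.
Proof.
move=> fY fZ fW Vx; apply/eqP; rewrite -subr_eq0 /tau.
set p := _ *m W x; set q := _ *m W x.
suff : p - q = 0.
  by move=> /(congr1 (fun A : 'M_(_, _) => A 0 0)); rewrite !mxE => ->.
rewrite -mulmxBl -mulmxBl -linearB /=.
apply: (eigenspace_isotropic (Jorth Vx)); last exact: fW.2.
rewrite /nabla (cconn_form_sym Vo gsym gunit _ _ Vx) opprD addrACA subrr addr0.
exact: bracket10.
Qed.

(** The symmetries of [tau] make it vanish on fields of type (1,0).  For a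
    vector w of type (1,0) at x, the field y |-> w - i J(y) w is of type (1,0) and
    takes the value 2 w at x. *)
Lemma nabla10 Y Z : field10 a V Y -> field10 a V Z -> field10 a V (nabla a Y Z).
Proof.
move=> fY fZ; split.
  by apply/csmooth_onP; apply: csmooth_nabla; exact: field10_smooth.
move=> x Vx; apply: (eigenspace_orthogonal (Jorth Vx) (Jsq Vx) (gunit Vx)) => w Jw.
pose W y := w - 'i%C *: (cmx (J y) *m w).
have fW : field10 a V W.
  split; last by move=> y Vy; exact: (eigenspace_projection (Jsq Vy)).
  apply/csmooth_onP; apply: csmooth_mxD => //; first exact: csmooth_mx_cst.
  rewrite (_ : (fun y => _) = (fun y => (- 'i%C) *: (cmx (J y) *m w))).
    apply: csmooth_mxZ => //; first exact: csmooth_cst.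
    by apply: csmooth_mxM => //; [exact: csmooth_cmx|exact: csmooth_mx_cst].
  by apply/funext => y; rewrite scaleNr.
have Wx : W x = 2 *: w.
  by rewrite /W Jw scalerA imaginary_sq scaleN1r opprK -mulr2n scaler_nat.
have t0 : tau Y Z W x = 0.
  have tN : tau Y Z W x = - tau Y Z W x.
    (* Applied in alternation, the two symmetries run through the six orders of
       Y, Z, W and come back to the first one with the sign (-1)^3. *)
    rewrite {1}(tau_sym fY fZ fW Vx) (tau_antisym Z fY fW Vx).
    rewrite (tau_sym fZ fW fY Vx) (tau_antisym W fZ fY Vx).
    rewrite (tau_sym fW fY fZ Vx) (tau_antisym Y fW fZ Vx).
    by rewrite !opprK.
  exact: (@eq_opp_0 R R[i]^o).
have := t0; rewrite /tau Wx -scalemxAr mxE => /eqP.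
rewrite mulf_eq0 pnatr_eq0 /= => /eqP h.
by apply/matrixP => i j; rewrite !ord1 h mxE.
Qed.

End HolomorphicTangentBundle.

(** * The eigenbundle defined by a map to the twistor space *)

Section TwistorLift.
Context {R : realType}.
Variables (n m : nat) (N : oriented_riemannian_manifold R n.*2)
  (M : hermitian_manifold R m) (psi : M -> twistor N).
Hypothesis psi_hol : J1_holomorphic psi.

Let phi : M -> N := twistor_proj (N := N) \o psi.

Variables (a : chart_index M) (b : chart_index N) (V : set 'cV[R]_m).
Hypotheses (Vo : open V) (Vab : V `<=` local_dom phi a b).

Let J := endo_rep psi a b.
Let f := local_rep phi a b.
Let g := metric b.

Let chart_facts x : V x ->
  mimg a x /\ mdom b (twistor_proj (psi (micoord a x))).
Proof.
move=> /Vab[p [pa pb] <-]; split; first by exists p.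
by rewrite /micoord /mcoord coordK.
Qed.

Let Va : V `<=` mimg a.
Proof. by move=> x /chart_facts[]. Qed.

Let fb x : V x -> mimg b (f x).
Proof. by move=> /chart_facts[_ xb]; exists (phi (micoord a x)). Qed.

Let fsmooth : smooth_on V f.
Proof.
by move=> i j; apply: (smooth_subset Vab) => k; exact: psi_hol.1.1.2.
Qed.

Let Jsmooth : smooth_on V J.
Proof.
by move=> i j; apply: (smooth_subset Vab) => k; exact: psi_hol.1.2.
Qed.

Let Jsq x : V x -> J x *m J x = - 1%:M.
Proof. by move=> /chart_facts[_]; exact: endo_square. Qed.

Let Jorth x : V x -> (J x)^T *m g (f x) *m J x = g (f x).
Proof. by move=> /chart_facts[_]; exact: endo_orthogonal. Qed.

(** Smooth sections over V of the bundle E of eigenvectors of J_psi. *)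
Definition section10 (s : 'cV[R]_m -> 'cV[R[i]]_n.*2) : Prop :=
  csmooth_mx V s /\ forall x, V x -> cmx (J x) *m s x = 'i%C *: s x.

Lemma section10_lin c s t : section10 s -> section10 t ->
  section10 (fun x => c *: s x + t x).
Proof.
move=> [ss sJ] [ts tJ]; split=> [|x Vx].
  apply: csmooth_mxD => //; apply: csmooth_mxZ => //; exact: csmooth_cst.
by rewrite mulmxDr -scalemxAr sJ // tJ // scalerDr !scalerA mulrC.
Qed.

Lemma section10_sum (I : Type) (r : seq I) F :
  (forall k : I, section10 (F k)) -> section10 (fun x => \sum_(k <- r) F k x).
Proof.
move=> sF; split=> [|x Vx].
  by apply: csmooth_mx_sum => // k; case: (sF k).
rewrite mulmx_sumr scaler_sumr; apply: eq_bigr => k _.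
by case: (sF k) => _ ->.
Qed.

(** Horizontal and vertical components of J1-holomorphy. *)
Let holo x : V x -> forall X,
  jac f x *m (acs a x *m X) = J x *m (jac f x *m X) /\
  vpart b (f x) (J x) (dpsi psi a b x (acs a x *m X)) =
  J x *m vpart b (f x) (J x) (dpsi psi a b x X).
Proof.
move=> Vx X; have E := psi_hol.2 a b x X (Vab Vx).
have E1 : (dpsi psi a b x (acs a x *m X)).1 = J x *m (dpsi psi a b x X).1.
  by rewrite E /= addr0.
split=> //; rewrite {1}/vpart E1 E /=.
by rewrite addrC addKr.
Qed.

Lemma csmooth_pushforward Y : csmooth_mx V Y ->
  csmooth_mx V (pushforward phi a b Y).
Proof.
move=> sY; apply: csmooth_mxM => //; apply: csmooth_cmx => k i.
rewrite (_ : (fun x => _) = partial (fun y => f y k 0) i).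
  exact/smooth_partial/fsmooth.
by apply/funext => x; rewrite mxE.
Qed.

Lemma pushforward10 Y : field10 a V Y -> section10 (pushforward phi a b Y).
Proof.
move=> fY; split; first by apply: csmooth_pushforward; exact: field10_smooth fY.
move=> x Vx; have JJ : J x *m jac f x = jac f x *m acs a x.
  apply/matrixP => k i; have [H _] := holo Vx (delta_mx i 0).
  move/(congr1 (fun A : 'cV_n.*2 => A k 0)): H.
  by rewrite !mulmxA -!colE [LHS]mxE [RHS]mxE.
rewrite /pushforward mulmxA -cmxM JJ cmxM -mulmxA.
by case: fY => _ ->; rewrite // scalemxAr.
Qed.

(** Complex-linear extension of X |-> vpart (dpsi X), the covariant derivative
    of J_psi along X. *)
Let nablaJ x (v : 'cV[R[i]]_m) : 'M[R[i]]_n.*2 :=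
  let Gamma := cconn_form g (f x) (cmx (jac f x) *m v) in
  mderive (fun y => cmx (J y)) x v - (cmx (J x) *m Gamma - Gamma *m cmx (J x)).

Let nablaJ_lin x c u v : nablaJ x (c *: u + v) = c *: nablaJ x u + nablaJ x v.
Proof.
rewrite /nablaJ mderive_lin mulmxDr -scalemxAr cconn_form_lin.
rewrite mulmxDr mulmxDl -scalemxAr -scalemxAl.
by apply/matrixP => k l; rewrite !mxE; ring.
Qed.

Let nablaJ_real x X :
  nablaJ x (cmx X) = cmx (vpart b (f x) (J x) (dpsi psi a b x X)).
Proof.
rewrite /nablaJ /vpart /=.
have -> : mderive (fun y => cmx (J y)) x (cmx X) = cmx (dpsi psi a b x X).2.
  apply/matrixP => k l; rewrite mderiveE !mxE rmorph_sum; apply: eq_bigr => i _.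
  rewrite (_ : (fun y => _) = fun y => (J y k l)%:C).
    by rewrite cpartial_real mxE rmorphM.
  by apply/funext => y; rewrite mxE.
have -> : cconn_form g (f x) (cmx (jac f x) *m cmx X) =
    cmx (conn_form g (f x) (jac f x *m X)).
  rewrite -cmxM /cmx map_mx_sum; apply: eq_bigr => i _.
  by rewrite map_mxZ mxE.
by rewrite -!cmxM -!map_mxB.
Qed.

(** Complex-linear extension of nabla_(J X) J_psi = J_psi nabla_X J_psi. *)
Lemma nablaJ10 x (v : 'cV[R[i]]_m) : V x -> cmx (acs a x) *m v = 'i%C *: v ->
  cmx (J x) *m nablaJ x v = 'i%C *: nablaJ x v.
Proof.
move=> Vx Jv.
have Eim : acs a x *m Immx v = Remx v by rewrite -Immx_cmxM Jv Immx_i.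
rewrite (cmatrix_split v) nablaJ_lin !nablaJ_real.
rewrite -Eim (holo Vx _).2; set P := vpart _ _ _ _.
rewrite mulmxDr -scalemxAr -!cmxM mulmxA Jsq // mulNmx mul1mx cmxN.
by rewrite scalerDr scalerA imaginary_sq scaleN1r addrC.
Qed.

Lemma nabla_pullbackE Y s x : nabla_pullback phi a b Y s x =
  mderive s x (Y x) + cconn_form g (f x) (pushforward phi a b Y x) *m s x.
Proof. by rewrite /nabla_pullback cderiveE. Qed.

(** With e = J_psi t - i t for t = nabla_Y s, the Leibniz rule gives
    (nabla_Y J_psi) s = - e.  Hence J_psi e = i e by [nablaJ10], whereas
    J_psi e = - i e because J_psi^2 = -1. *)
Lemma nabla_pullback10 Y s : field10 a V Y -> section10 s ->
  section10 (nabla_pullback phi a b Y s).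
Proof.
move=> fY [ss sJ]; have sY := field10_smooth fY.
have gunit y : mimg b y -> g y \in unitmx by exact: metric_unitmx.
have bo : open (mimg b) by exact: img_open.
split.
  rewrite (_ : nabla_pullback phi a b Y s = fun x => mderive s x (Y x) +
    cconn_form g (f x) (pushforward phi a b Y x) *m s x); last first.
    by apply/funext => x; exact: nabla_pullbackE.
  apply: csmooth_mxD => //; first exact: csmooth_mderive.
  apply: csmooth_mxM => //; apply: csmooth_mx_sum => // i.
  apply: csmooth_mxZ => //; first exact: csmooth_pushforward.
  apply: csmooth_cmx => k j.
  apply: (smooth_comp Vo (f := fun y => conn_coef g y i k j) _ fsmooth fb).
  exact: (smooth_conn_coef bo (@metric_smooth _ _ _ b) gunit i).
move=> x Vx; set t := nabla_pullback _ _ _ _ _ _.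
pose e := cmx (J x) *m t - 'i%C *: t.
have D : nablaJ x (Y x) *m s x = - e.
  have dJs : mderive (fun y => cmx (J y)) x (Y x) *m s x =
      'i%C *: mderive s x (Y x) - cmx (J x) *m mderive s x (Y x).
    apply/eqP; rewrite eq_sym subr_eq -(mderiveM Vo _ (csmooth_cmx Jsmooth) ss Vx).
    rewrite (mderive_ext Vo (Y x) Vx sJ); apply/eqP.
    rewrite (_ : (fun y => 'i%C *: s y) = (fun y => 'i%C%:M *m s y)); last first.
      by apply/funext => y; rewrite mul_scalar_mx.
    rewrite (mderiveM Vo _ (csmooth_mx_cst _ _) ss Vx) mderive_cst mul0mx add0r.
    by rewrite mul_scalar_mx.
  rewrite /nablaJ mulmxBl dJs mulmxBl -(mulmxA _ (cmx (J x)) (s x)) sJ //.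
  rewrite -scalemxAr /e /t nabla_pullbackE mulmxDr -mulmxA.
  rewrite -/(pushforward phi a b Y x).
  by apply/matrixP => k l; rewrite !mxE; ring.
have JE : cmx (J x) *m e = 'i%C *: e.
  have := congr1 (mulmx^~ (s x)) (nablaJ10 Vx (fY.2 x Vx)).
  by rewrite /= -mulmxA D -scalemxAl D mulmxN scalerN => /oppr_inj.
have JE' : cmx (J x) *m e = - ('i%C *: e).
  rewrite /e mulmxBr -scalemxAr mulmxA -cmxM Jsq // cmxN /cmx map_mx1 mulNmx.
  rewrite mul1mx scalerBr scalerA imaginary_sq scaleN1r opprK.
  by rewrite [RHS]opprD [RHS]addrC.
have iE0 : 'i%C *: e = 0 by apply: eq_opp_0; rewrite -{1}JE.
apply: subr0_eq; rewrite -/e -[e]opprK -(scaleN1r e) -imaginary_sq -scalerA.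
by rewrite iE0 scaler0 oppr0.
Qed.

Lemma nabla_d10 r (Z : 'I_r.+1 -> 'cV[R]_m -> 'cV[R[i]]_m) :
  (forall k, field10 a V (Z k)) -> section10 (nabla_d phi a b Z).
Proof.
elim: r Z => [|r IHr] Z fZ; first exact: pushforward10.
have sN s t : section10 s -> section10 t -> section10 (fun x => t x - s x).
  move=> ss st; rewrite (_ : (fun x => _) = (fun x => -1 *: s x + t x)).
    exact: section10_lin.
  by apply/funext => x; rewrite scaleN1r addrC.
apply: sN.
  apply: section10_sum => j; apply: IHr => k; case: ifP => _ //.
  exact: nabla10.
by apply: nabla_pullback10 => //; exact: IHr.
Qed.

Lemma section10_isotropic s t x : section10 s -> section10 t -> V x ->
  cmetric b (f x) (s x) (t x) = 0.
Proof.
move=> [_ sJ] [_ tJ] Vx.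
by rewrite /cmetric (eigenspace_isotropic (Jorth Vx) (sJ x Vx) (tJ x Vx)) mxE.
Qed.

End TwistorLift.

Theorem mainTheorem8 (R : realType) (n m : nat)
    (N : oriented_riemannian_manifold R n.*2) (M : hermitian_manifold R m.*2)
    (psi : M -> twistor N) :
  J1_holomorphic psi -> real_isotropic (twistor_proj (N := N) \o psi).
Proof.
move=> psi_hol; split; first exact: psi_hol.1.1.
move=> a b V Vo Vab r s _ _ Z W fZ fW x Vx.
by apply: (section10_isotropic Vab _ _ Vx); exact: (nabla_d10 psi_hol Vo Vab).
Qed.
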